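(* Let $d\ge 1$ and $n\ge 2$ be integers. For each $i\in\{1,\dots,d+1\}$ let $\delta_i\in\mathbb{R}^d$, let $\vec{\mathbf a}_i$ be an infinite matrix with $d$ rows, infinitely many columns and entries in $\{0,1,\dots,n-1\}$, let $\mathcal L_{\vec{\mathbf a}_i}$ be its location function, and let $\mathcal G(\delta_i,\mathcal L_{\vec{\mathbf a}_i})$ be the corresponding $n$-adic grid in $\mathbb{R}^d$. Then the $n$-adic grids $\mathcal G(\delta_1,\mathcal L_{\vec{\mathbf a}_1}),\dots,\mathcal G(\delta_{d+1},\mathcal L_{\vec{\mathbf a}_{d+1}})$ are adjacent if and only if the following two conditions hold: (1) For any $\ell_1,\ell_2\in\{1,\dots,d+1\}$ with $\ell_1\ne\ell_2$ and any $s\in\{1,\dots,d\}$, the number $(\delta_{\ell_1})_s-(\delta_{\ell_2})_s$ is $n$-far, that is, there exists a constant $C(\ell_1,\ell_2,s)>0$ such that for all integers $m\ge 0$ and all $k\in\mathbb{Z}$, $$\left|(\delta_{\ell_1})_s-(\delta_{\ell_2})_s-\frac{k}{n^m}\right|\ge\frac{C(\ell_1,\ell_2,s)}{n^m}.$$ (2) For any $k_1,k_2\in\{1,\dots,d+1\}$ with $k_1\ne k_2$ and any $s\in\{1,\dots,d\}$, $$0<\liminf_{j\to\infty}\left|\frac{[\mathcal L_{\vec{\mathbf a}_{k_1}}(j)]_s-[\mathcal L_{\vec{\mathbf a}_{k_2}}(j)]_s}{n^j}\right|\le\limsup_{j\to\infty}\left|\frac{[\mathcal L_{\vec{\mathbf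 a}_{k_1}}(j)]_s-[\mathcal L_{\vec{\mathbf a}_{k_2}}(j)]_s}{n^j}\right|<1.$$
   Context: Throughout, the location functions are defined on $\mathbb{N}=\{0,1,2,\dots\}$, and for a vector $v\in\mathbb{R}^d$, $(v)_s$ or $[v]_s$ denotes its $s$-th component. Cubes are axis-parallel, and $\ell(Q)>0$ denotes the sidelength of a cube $Q$. An $n$-adic grid in $\mathbb{R}^d$ is a collection $\mathcal G$ of left-closed, right-open cubes $[a_1,a_1+\ell)\times\dots\times[a_d,a_d+\ell)$ such that: (i) every $Q\in\mathcal G$ has sidelength $n^k$ for some $k\in\mathbb{Z}$; (ii) $Q\cap R\in\{Q,R,\emptyset\}$ for all $Q,R\in\mathcal G$; (iii) for each fixed $k\in\mathbb{Z}$, the cubes in $\mathcal G$ of sidelength $n^k$ form a partition of $\mathbb{R}^d$. Location function: for an infinite matrix $\vec{\mathbf a}=\{\vec a_0,\vec a_1,\dots\}$ with columns $\vec a_j\in\{0,\dots,n-1\}^d$ ($j\ge 0$), define $\mathcal L_{\vec{\mathbf a}}:\mathbb{N}\to\mathbb{Z}^d$ by $\mathcal L_{\vec{\mathbf a}}(0)=\vec 0$ and $\mathcal L_{\vec{\mathbf a}}(j)=\sum_{i=0}^{j-1}n^i\vec a_i$ for $j\ge 1$. The grid $\mathcal G(\delta,\mathcal L_{\vec{\mathbf a}})$: for $\delta\in\mathbb{R}^d$ it is the union over $m\in\mathbb{Z}$ of the $m$-th generations $\mathcal G(\delta,\mathcal L_{\vec{\mathbf a}})_m$, consisting of all cubes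 $$\prod_{s=1}^d\left[(v_m)_s+\frac{k_s}{n^m},\,(v_m)_s+\frac{k_s+1}{n^m}\right),\qquad (k_1,\dots,k_d)\in\mathbb{Z}^d,$$ where $v_m=\delta$ for $m\ge 0$ and $v_m=\delta+\mathcal L_{\vec{\mathbf a}}(-m)$ for $m<0$. Adjacency: $d+1$ $n$-adic grids $\mathcal G_1,\dots,\mathcal G_{d+1}$ in $\mathbb{R}^d$ are adjacent if for any cube $Q\subseteq\mathbb{R}^d$ (or any ball) there exist $i\in\{1,\dots,d+1\}$ and $R\in\mathcal G_i$ such that (1) $Q\subseteq R$, and (2) $\ell(R)\le C_{d,n}\,\ell(Q)$, where $C_{d,n}$ is a dimension constant that only depends on $d$ and $n$.
   Formalization: In the definition of adjacency the constant is uniform over all cubes Q but may depend on the given grids, not only on d and n; with one constant for all families the ''if'' direction fails, since the n-far constants can be arbitrarily small. *)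

(* Defs.v *)
From HB Require Import structures.
From mathcomp Require Import all_boot all_order all_algebra.
From mathcomp Require Import all_classical all_reals all_analysis.

Set Implicit Arguments.
Unset Strict Implicit.
Unset Printing Implicit Defensive.

Import Order.TTheory GRing.Theory Num.Theory.

Local Open Scope classical_set_scope.
Local Open Scope ring_scope.

Record cube (R : realType) (d : nat) := Cube {
  corner : 'rV[R]_d;
  side : R;
  side_gt0 : 0 < side }.

(* The left-closed, right-open cube
   [c_1, c_1 + l[ x ... x [c_d, c_d + l[. *)
Definition hopen (R : realType) (d : nat) (Q : cube R d) : set 'rV[R]_d :=
  [set x | forall s, x 0 s \in `[corner Q 0 s, corner Q 0 s + side Q[].

(* An axis-parallel cube in which each of the 2 d faces may be included or
   not. As in MathComp intervals, BSide b is a closed bound when b is true on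
   the left, and when b is false on the right. *)
Definition cube_faces (R : realType) (d : nat) (b : 'I_d -> bool * bool)
    (Q : cube R d) : set 'rV[R]_d :=
  [set x | forall s, x 0 s \in Interval (BSide (b s).1 (corner Q 0 s))
                                 (BSide (b s).2 (corner Q 0 s + side Q))].

Record is_nadic_grid (R : realType) (d n : nat) (G : set (cube R d)) : Prop :=
  IsNadicGrid {
    nadic_side : forall Q, G Q -> exists k : int, side Q = n%:R ^ k;
    nadic_nested : forall Q Q', G Q -> G Q' ->
      [\/ hopen Q `&` hopen Q' = hopen Q, hopen Q `&` hopen Q' = hopen Q'
        | hopen Q `&` hopen Q' = set0];
    nadic_partition : forall k : int,
      partition [set Q | G Q /\ side Q = n%:R ^ k] (@hopen R d) [set: 'rV[R]_d]
  }.

Record nadicGrid (R : realType) (d n : nat) := NadicGrid {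
  grid_cubes : set (cube R d);
  grid_cubesP : is_nadic_grid n grid_cubes }.

(* a j is the j-th column of the infinite matrix, with entries in
   {0, ..., n - 1}. *)
Definition location (d n : nat) (a : nat -> 'rV['I_n]_d) (j : nat) :
    'rV[int]_d :=
  \row_s \sum_(i < j) n%:Z ^+ i * (a i 0 s : nat)%:Z.

Definition origin (R : realType) (d n : nat) (delta : 'rV[R]_d)
    (a : nat -> 'rV['I_n]_d) (m : int) : 'rV[R]_d :=
  if 0 <= m then delta
  else delta + map_mx intr (location a `|m|%N).

Definition generation (R : realType) (d n : nat) (delta : 'rV[R]_d)
    (a : nat -> 'rV['I_n]_d) (m : int) : set (cube R d) :=
  [set Q | exists k : 'rV[int]_d,
     (forall s, corner Q 0 s = origin delta a m 0 s + (k 0 s)%:~R / n%:R ^ m) /\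
     side Q = 1 / n%:R ^ m].

Definition location_cubes (R : realType) (d n : nat) (delta : 'rV[R]_d)
    (a : nat -> 'rV['I_n]_d) : set (cube R d) :=
  \bigcup_(m in [set: int]) generation delta a m.

Section LocationGrid.
Variables (R : realType) (d n : nat) (delta : 'rV[R]_d).
Variables (a : nat -> 'rV['I_n]_d).
Hypothesis n_gt1 : (1 < n)%N.

Let n_gt0 : 0 < n%:R :> R. Proof. by rewrite ltr0n ltnW. Qed.
Let n_neq0 : n%:R != 0 :> R. Proof. by rewrite gt_eqF. Qed.
Let nX_gt0 (m : int) : 0 < n%:R ^ m :> R. Proof. by rewrite exprz_gt0. Qed.
Let nX_neq0 (m : int) : n%:R ^ m != 0 :> R. Proof. by rewrite gt_eqF. Qed.

Let nX_inj (m m' : int) : n%:R ^ m = n%:R ^ m' :> R -> m = m'.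
Proof. by apply: ieexprIz => //; rewrite pnatr_eq1 gtn_eqF. Qed.

Lemma cube_eq (Q Q' : cube R d) :
  corner Q = corner Q' -> side Q = side Q' -> Q = Q'.
Proof.
case: Q Q' => [c l l0] [c' l' l0'] /= ec el; subst c' l'.
by rewrite (bool_irrelevance l0 l0').
Qed.

Lemma location_sub (i j : nat) (s : 'I_d) : (i <= j)%N ->
  exists p : int, location a j 0 s = location a i 0 s + p * n%:Z ^+ i.
Proof.
move=> ij; rewrite -(subnKC ij); elim: (j - i)%N => [|k [p IH]].
  by exists 0; rewrite addn0 mul0r addr0.
exists (p + n%:Z ^+ k * (a (i + k) 0 s : nat)%:Z).
rewrite addnS; move: IH; rewrite !mxE big_ord_recr /= => ->.
by rewrite mulrDl addrA mulrAC -exprD addnC.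
Qed.

(* The generation-m origins lie in the generation-m' lattice for m <= m'. *)
Lemma origin_sub (m m' : int) (s : 'I_d) : m <= m' ->
  exists p : int, origin delta a m 0 s =
                  origin delta a m' 0 s + p%:~R / n%:R ^ m'.
Proof.
rewrite /origin; case: ifPn => [m0|].
  by move=> /(le_trans m0) ->; exists 0; rewrite mul0r addr0.
rewrite -ltNge => m0 mm'; case: ifPn => [|].
  case: m' mm' => // j _ _.
  exists (location a `|m|%N 0 s * n%:Z ^+ j).
  rewrite !mxE intrM rmorphXn /= mulfK //.
  by have := nX_neq0 j.
rewrite -ltNge => m'0.
have le_mm' : (`|m'| <= `|m|)%N.
  by rewrite -lez_nat !ltz0_abs // lerN2.
have [p ep] := location_sub s le_mm'.
exists p; rewrite !mxE; move: ep; rewrite !mxE => ->.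
rewrite intrD intrM rmorphXn /= addrA; congr (_ + _ * _).
by rewrite exprnP ltz0_abs // -invr_expz.
Qed.

Lemma generation_sub (m m' : int) (Q Q' : cube R d) : m <= m' ->
  generation delta a m Q -> generation delta a m' Q' ->
  hopen Q `&` hopen Q' !=set0 -> hopen Q' `<=` hopen Q.
Proof.
move=> mm' [k [ck sk]] [k' [ck' sk']] [x [Qx Q'x]] y Q'y s.
have [p ep] := origin_sub s mm'.
have [j ej] : exists j : nat, m' = m + j%:Z.
  by exists `|m' - m|%N; rewrite gez0_abs ?subr_ge0// [RHS]addrC subrK.
have eV : (n%:R ^ m)^-1 = n%:R ^+ j / n%:R ^ m' :> R.
  by rewrite ej expfzDr // -exprnP invfM mulrCA divff ?mulr1 // expf_neq0.
move: (Qx s) (Q'x s) (Q'y s).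
rewrite !in_itv /= !ck !ck' sk sk' !div1r eV ep.
set v := origin _ _ _ _ _; set u := (n%:R ^ m')^-1.
have u0 : 0 < u by rewrite invr_gt0.
have -> : n%:R ^+ j = (n%:Z ^+ j)%:~R :> R by rewrite rmorphXn.
set q := n%:Z ^+ j; set z := k 0 s; set w := k' 0 s.
have -> : v + p%:~R * u + z%:~R * (q%:~R * u) = v + (p + z * q)%:~R * u.
  by rewrite mulrA -addrA -mulrDl -intrM -intrD.
have -> : v + (p + z * q)%:~R * u + q%:~R * u = v + (p + z * q + q)%:~R * u.
  by rewrite -addrA -mulrDl -intrD.
have -> : v + w%:~R * u + u = v + (w + 1)%:~R * u.
  by rewrite intrD mulrDl mul1r addrA.
move=> /andP[x1 x2] /andP[x3 x4] /andP[x5 x6].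
have := le_lt_trans x3 x2; have := le_lt_trans x1 x4.
rewrite !ltrD2l !ltr_pM2r // !ltr_int ltzD1 => lew wlt.
apply/andP; split.
  by apply: le_trans x5; rewrite lerD2l ler_pM2r // ler_int.
by apply: (lt_le_trans x6); rewrite lerD2l ler_pM2r // ler_int lezD1.
Qed.

Lemma location_cubesP : is_nadic_grid n (location_cubes delta a).
Proof.
have sideE m Q : generation delta a m Q -> side Q = n%:R ^ (- m).
  by case=> k [_ ->]; rewrite div1r invr_expz.
split.
- by move=> Q [m _ /sideE ->]; exists (- m).
- move=> Q Q' [m _ Qm] [m' _ Q'm'].
  have [->|/set0P QQ'] := eqVneq (hopen Q `&` hopen Q') set0.
    exact: Or33.
  have [mm'|/ltW m'm] := leP m m'.
    by apply: Or32; apply/setIidr; apply: (generation_sub mm' Qm Q'm').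
  apply: Or31; apply/setIidl; apply: (generation_sub m'm Q'm' Qm).
  by rewrite setIC.
- move=> k; split.
  + apply/seteqP; split => // x _.
    pose o := origin delta a (- k).
    pose c : 'rV[R]_d :=
      \row_s (o 0 s + (Num.floor ((x 0 s - o 0 s) / n%:R ^ k))%:~R * n%:R ^ k).
    exists (Cube c (nX_gt0 k)) => [|s] /=.
      split=> //; exists (- k) => //.
      exists (\row_s Num.floor ((x 0 s - o 0 s) / n%:R ^ k)).
      by split=> [s|]; rewrite ?mxE ?div1r (invr_expz _ (- k)) opprK.
    have /andP[le1 lt1] := floor_itv ((x 0 s - o 0 s) / n%:R ^ k).
    rewrite in_itv /= mxE -lerBrDl -addrA -ltrBlDl -ler_pdivlMr // le1 /=.
    by rewrite intrD ltr_pdivrMr // mulrDl mul1r in lt1.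
  + move=> Q Q' [[m _ Qm] Qk] [[m' _ Q'm'] Q'k] [x [Qx Q'x]].
    have em : m = - k.
      by apply: oppr_inj; rewrite opprK; apply: nX_inj; rewrite -Qk (sideE m).
    have em' : m' = - k.
      by apply: oppr_inj; rewrite opprK; apply: nX_inj; rewrite -Q'k (sideE m').
    subst m m'.
    have ne : hopen Q `&` hopen Q' !=set0 by exists x.
    have ne' : hopen Q' `&` hopen Q !=set0 by exists x.
    have sQ := generation_sub (lexx _) Qm Q'm' ne.
    have sQ' := generation_sub (lexx _) Q'm' Qm ne'.
    have cornerP (P : cube R d) : hopen P (corner P).
      by move=> s; rewrite in_itv /= lexx ltrDl side_gt0.
    apply: cube_eq; last by rewrite Qk Q'k.
    apply/rowP => s; apply/eqP; rewrite eq_le.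
    move: (sQ _ (cornerP Q') s) (sQ' _ (cornerP Q) s).
    by rewrite !in_itv /= => /andP[-> _] /andP[-> _].
  + move=> Q _; exists (corner Q) => s.
    by rewrite in_itv /= lexx ltrDl side_gt0.
Qed.

Definition location_grid : nadicGrid R d n := NadicGrid location_cubesP.

End LocationGrid.

(* The constant is uniform over all cubes Q (of any size, position and
   boundary type), but may depend on the given family of grids. *)
Definition adjacent_grids (R : realType) (d n : nat)
    (G : 'I_d.+1 -> nadicGrid R d n) : Prop :=
  exists C : R, 0 < C /\
    forall (b : 'I_d -> bool * bool) (Q : cube R d),
      exists (i : 'I_d.+1) (Q' : cube R d),
        [/\ grid_cubes (G i) Q', cube_faces b Q `<=` hopen Q'
          & side Q' <= C * side Q].

Definition n_far (R : realType) (n : nat) (x : R) : Prop :=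
  exists C : R, 0 < C /\
    forall (m : nat) (k : int), `|x - k%:~R / n%:R ^+ m| >= C / n%:R ^+ m.

Definition location_gap (R : realType) (d n : nat)
    (a a' : nat -> 'rV['I_n]_d) (s : 'I_d) (j : nat) : R :=
  `|(location a j 0 s - location a' j 0 s)%:~R / n%:R ^+ j|.

(* Main.v *)
Require Import Defs.
From mathcomp Require Import all_boot all_order all_algebra.
From mathcomp Require Import all_classical all_reals all_analysis.
From mathcomp Require Import perm zify ring lra.

Import Order.TTheory GRing.Theory Num.Theory.

Local Open Scope classical_set_scope.
Local Open Scope ring_scope.

(** Adjacency is decided one coordinate and one pair of grids at a time. Call
    boundary points of a grid, in coordinate s and generation m, the points
    v_m + k / n^m, which bound the s-th sides of its generation-m cubes. The
    grids are adjacent exactly when any two of them keep, in each coordinate and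
    each generation m, their boundary points at distance at least c / n^m, with
    c > 0 independent of m ([adjacent_gridsP]).

    If they do, let Q be a cube and m a generation of sidelength above
    side Q / c, by a factor at most n. A grid without a generation-m cube around
    Q has a boundary
    point inside some side of Q ([fits_or_crosses]). If this happened to all
    d + 1 grids, two of them would have boundary points in the same side of Q by
    the pigeonhole principle, and these points would be too close.

    If they do not, some side of length l, tiny compared with n^-m, crosses
    boundary points of two grids at once. There are d - 1 other sides and d - 1
    other grids, so the corner of a cube of side l can be chosen to make every
    grid cross some side at generation m. Since boundary points persist in finer
    generations, any grid cube around this cube has sidelength more than n^-m
    ([crosses_coarser]), which no constant can compare with l.

    It remains to read the separation of two grids off their parameters
    ([far_originsP]). For m >= 0 it says that the difference x of the origins is
    n-far. For m = - j < 0 it bounds the distance of x + D_j to the multiples of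
    n^j from below by c n^j, where D_j is the difference of the locations. As
    x / n^j tends to 0 and |D_j| < n^j, only the multiples 0, n^j and - n^j
    compete for large j, so this amounts to |D_j| / n^j staying away from 0 and
    from 1: these are the liminf and limsup conditions. The finitely many small
    j cost nothing more, because D_j - k n^j is an integer and x is n-far. *)

(** * Strict bounds on upper and lower limits *)

Lemma limn_esup_ltP (R : realType) (u : nat -> \bar R) (x : \bar R) :
  (limn_esup u < x)%E <->
  exists2 y, (y < x)%E & \forall j \near \oo, (u j <= y)%E.
Proof.
split=> [/ereal_inf_lt[_ [V Voo <-]] lt_x | [y y_lt_x uy]].
  exists (ereal_sup [set u j | j in V]) => //.
  by apply: filterS Voo => j Vj; apply: ereal_sup_ubound; exists j.
apply: le_lt_trans y_lt_x.
apply: (@le_trans _ _ (ereal_sup (u @` [set j | (u j <= y)%E]))).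
  by apply: ereal_inf_lbound; exists [set j | (u j <= y)%E].
by apply: ge_ereal_sup => _ [j uj <-].
Qed.

Lemma limn_esup_lt_finP {R : realType} (u : nat -> R) (x : R) :
  (limn_esup (fun j => (u j)%:E) < x%:E)%E <->
  exists2 e : R, 0 < e & \forall j \near \oo, u j <= x - e.
Proof.
rewrite limn_esup_ltP; split=> [[y y_lt_x uy] | [e e0 ue]].
  case: y y_lt_x uy => [r|//|_ [N _ uN]].
    rewrite lte_fin => r_lt_x ur; exists (x - r); first by rewrite subr_gt0.
    by apply: filterS ur => j; rewrite lee_fin subKr.
  by have := uN N (leqnn N); rewrite /= leNgt ltNyr.
exists (x - e)%:E; first by rewrite lte_fin ltrBlDr ltrDl.
by apply: filterS ue => j; rewrite lee_fin.
Qed.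

Lemma lt_limn_einf_finP (R : realType) (u : nat -> R) (x : R) :
  (x%:E < limn_einf (fun j => (u j)%:E))%E <->
  exists2 e : R, 0 < e & \forall j \near \oo, x + e <= u j.
Proof.
rewrite /limn_einf lteNr -EFinN.
rewrite (limn_esup_lt_finP (fun j => - u j)).
by split=> -[e e0 ue]; exists e => //; apply: filterS ue => j;
  rewrite -opprD lerN2.
Qed.

(** * Powers of n *)

(** The inverse power is the sidelength of generation m, so this picks the
    generation that fits a given length up to a factor n. *)
Lemma expz_bracket {R : realType} (n : nat) {x : R} : (1 < n)%N -> 0 < x ->
  exists m : int, x < (n%:R ^ m)^-1 <= n%:R * x.
Proof.
move=> n_gt1 x0; have n0 : 0 < n%:R :> R by rewrite ltr0n ltnW.
have lnn : 0 < ln n%:R :> R by rewrite ln_gt0 // ltr1n.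
pose k := Num.floor (ln x / ln n%:R).
have expzE (j : int) : ln (n%:R ^ j) = j%:~R * ln n%:R :> R.
  by rewrite -powR_intmul ?ln_powR // ltW.
have nX0 (j : int) : (n%:R ^ j : R) \is Num.pos by rewrite posrE exprz_gt0.
exists (- (k + 1)); rewrite -invr_expz invrK.
have /andP[le_k lt_k] := floor_itv (ln x / ln n%:R).
apply/andP; split.
  by rewrite -ltr_ln ?nX0 ?posrE // expzE -ltr_pdivrMr.
rewrite expfzDr ?gt_eqF // expr1z mulrC ler_pM2l //.
by rewrite -ler_ln ?nX0 ?posrE // expzE -ler_pdivlMr.
Qed.

Lemma near_le_expn (R : realType) (n : nat) (x e : R) : (1 < n)%N -> 0 < e ->
  \forall j \near \oo, x <= e * n%:R ^+ j.
Proof.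
move=> n_gt1 e0; near=> j.
rewrite mulrC -ler_pdivrMr // (@le_trans _ _ j%:R) //.
  near: j; exact: nbhs_infty_ger.
by rewrite -natrX ler_nat ltnW // ltn_expl.
Unshelve. all: by end_near.
Qed.

(** * Separation of the boundary points of two grids *)

(** Boundary points of one generation m form translates of the lattice
    n^-m Z, so the distance between two such sets is the distance of the
    difference of the origins to this lattice. *)
Definition far_origins {R : realType} {d n : nat} (delta delta' : 'rV[R]_d)
    (a a' : nat -> 'rV['I_n]_d) (s : 'I_d) (c : R) : Prop :=
  forall m k : int, c / n%:R ^ m <=
    `|origin delta a m 0 s - origin delta' a' m 0 s - k%:~R / n%:R ^ m|.

Lemma origin_neg (R : realType) (d n : nat) (delta : 'rV[R]_d)
    (a : nat -> 'rV['I_n]_d) (j : nat) (s : 'I_d) :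
  origin delta a (- j%:Z) 0 s = delta 0 s + (location a j 0 s)%:~R.
Proof.
case: j => [|j].
  by rewrite /origin oppr0 lexx mxE big_ord0 addr0.
by rewrite /origin oppr_ge0 /= 3!mxE.
Qed.

Lemma location_itv {d n : nat} (a : nat -> 'rV['I_n]_d) (j : nat) (s : 'I_d) :
  0 <= location a j 0 s < n%:Z ^+ j.
Proof.
rewrite mxE; elim: j => [|j /andP[IH0 IH1]]; first by rewrite big_ord0.
rewrite big_ord_recr /= addr_ge0 ?mulr_ge0 ?exprn_ge0 //=.
have an : (a j 0 s : nat)%:Z + 1 <= n%:Z by rewrite lezD1 ltz_nat.
apply: (@lt_le_trans _ _ (n%:Z ^+ j * ((a j 0 s : nat)%:Z + 1))).
  by rewrite mulrDr mulr1 addrC ltrD2l.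
by rewrite exprSr ler_wpM2l // exprn_ge0.
Qed.

Lemma norm_locationB_lt (R : realType) {d n : nat} (a a' : nat -> 'rV['I_n]_d)
    (j : nat) (s : 'I_d) :
  `|(location a j 0 s - location a' j 0 s)%:~R| < n%:R ^+ j :> R.
Proof.
have /andP[a0 aj] := location_itv a j s.
have /andP[a'0 a'j] := location_itv a' j s.
have -> : n%:R ^+ j = (n%:Z ^+ j)%:~R :> R by rewrite rmorphXn.
rewrite -intr_norm ltr_int; lia.
Qed.

(** The generations of sidelength n^j, with the inverse powers cleared. *)
Lemma far_origins_negP (R : realType) (d n : nat) (delta delta' : 'rV[R]_d)
    (a a' : nat -> 'rV['I_n]_d) (s : 'I_d) (c : R) (j : nat) (k : int) :
  (c / n%:R ^ (- j%:Z) <= `|origin delta a (- j%:Z) 0 s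
      - origin delta' a' (- j%:Z) 0 s - k%:~R / n%:R ^ (- j%:Z)|) =
  (c * n%:R ^+ j <= `|(delta 0 s - delta' 0 s)
      + (location a j 0 s - location a' j 0 s)%:~R - k%:~R * n%:R ^+ j|).
Proof.
rewrite !origin_neg -invr_expz invrK -exprnP intrB.
by congr (_ <= `|_|); ring.
Qed.

Lemma location_gap_bounds (R : realType) (d n : nat)
    (a a' : nat -> 'rV['I_n]_d) (s : 'I_d) (j : nat) (e : R) : (1 < n)%N ->
  (e <= location_gap R a a' s j <= 1 - e) =
  (e * n%:R ^+ j <= `|(location a j 0 s - location a' j 0 s)%:~R : R|
    <= (1 - e) * n%:R ^+ j).
Proof.
move=> n_gt1; have N0 : 0 < n%:R ^+ j :> R by rewrite exprn_gt0 // ltr0n ltnW.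
by rewrite /location_gap normf_div (gtr0_norm N0) ler_pdivlMr // ler_pdivrMr.
Qed.

(** A single margin e replaces the two limits, so that it can be compared with
    the separation constant of the boundary points. *)
Lemma gap_limitsP (R : realType) (d n : nat) (a a' : nat -> 'rV['I_n]_d)
    (s : 'I_d) (u := fun j : nat => (location_gap R a a' s j)%:E) :
  [/\ (0 < limn_einf u)%E, (limn_einf u <= limn_esup u)%E
    & (limn_esup u < 1)%E] <->
  exists2 e : R, 0 < e &
    \forall j \near \oo, e <= location_gap R a a' s j <= 1 - e.
Proof.
split=> [[/lt_limn_einf_finP[e1 e10 inf1] _ /limn_esup_lt_finP[e2 e20 sup1]]|].
  exists (Num.min e1 e2); first by rewrite lt_min e10.
  near=> j; apply/andP; split.
    have : 0 + e1 <= location_gap R a a' s j by near: j.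
    by rewrite add0r; apply: le_trans; rewrite ge_min lexx.
  have : location_gap R a a' s j <= 1 - e2 by near: j.
  by move=> /le_trans; apply; rewrite lerB // ge_min lexx orbT.
move=> [e e0 ue]; split; [|exact: limn_einf_sup|].
  apply/lt_limn_einf_finP; exists e => //.
  by apply: filterS ue => j /andP[]; rewrite add0r.
by apply/limn_esup_lt_finP; exists e => //; apply: filterS ue => j /andP[].
Unshelve. all: by end_near.
Qed.

(** Nonnegative generations give n-farness. In generation - j the offset x of
    the origins is negligible against n^j, so what is separated from the
    multiples of n^j is the difference of locations; conversely the generations
    where x is not yet negligible are finitely many and are handled by
    n-farness at generation 0. *)
Lemma far_originsP (R : realType) (d n : nat) (delta delta' : 'rV[R]_d)
    (a a' : nat -> 'rV['I_n]_d) (s : 'I_d) : (1 < n)%N ->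
  (exists2 c : R, 0 < c & far_origins delta delta' a a' s c) <->
  n_far n (delta 0 s - delta' 0 s) /\
  (exists2 e : R, 0 < e &
    \forall j \near \oo, e <= location_gap R a a' s j <= 1 - e).
Proof.
move=> n_gt1.
have N0 j : 0 < n%:R ^+ j :> R by rewrite exprn_gt0 // ltr0n ltnW.
set x := delta 0 s - delta' 0 s.
pose D j : R := (location a j 0 s - location a' j 0 s)%:~R.
have D_lt j : `|D j| < n%:R ^+ j := norm_locationB_lt R a a' j s.
split=> [[c c0 far] | [[C [C0 xfar]] [e e0 gap]]].
  split; first by exists c; split=> // m k; have := far m k.
  exists (c / 2); first by rewrite divr_gt0.
  near=> j; rewrite location_gap_bounds // -/(D j).
  have xj : `|x| <= c / 2 * n%:R ^+ j.
    by near: j; apply: near_le_expn => //; rewrite divr_gt0.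
  have farj k : c * n%:R ^+ j <= `|x + D j - k%:~R * n%:R ^+ j|.
    by rewrite -far_origins_negP; apply: far.
  (* 0 bounds |D j| from below; n^j, or - n^j if D j < 0, keeps it from n^j. *)
  move: (farj 0) (farj 1) (farj (-1)) (D_lt j) (N0 j) xj => {farj}.
  rewrite mulrN1z mul0r subr0 mul1r mulN1r opprK.
  move: (n%:R ^+ j) (D j) => N y f0 f1 fN1 yN N_gt0 xN.
  apply/andP; split.
    by move: f0 (ler_normD x y) xN; lra.
  have [y0|y0] := leP 0 y.
    rewrite (ger0_norm y0) in yN *.
    have := ler_normB x (N - y); rewrite (_ : x - (N - y) = x + y - N); last ring.
    by rewrite (@ger0_norm _ (N - y)); lra.
  rewrite (ltr0_norm y0) in yN *.
  have := ler_normD x (y + N); rewrite addrA.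
  by rewrite (@ger0_norm _ (y + N)); lra.
(* From J on, x takes at most half of the margin e. *)
have [J _ largeJ] : \forall j \near \oo,
    e * n%:R ^+ j <= `|D j| <= (1 - e) * n%:R ^+ j /\
    `|x| <= e / 2 * n%:R ^+ j.
  near=> j; split; first by rewrite -location_gap_bounds //; near: j.
  by near: j; apply: near_le_expn => //; rewrite divr_gt0.
have NJ : 1 <= n%:R ^+ J :> R by rewrite exprn_ege1 // ler1n ltnW.
exists (Num.min (e / 2) (C / n%:R ^+ J)).
  by rewrite lt_min !divr_gt0.
have CJ : C / n%:R ^+ J <= C by rewrite ler_pdivrMr // ler_peMr // ltW.
move=> [m|m] k.
  apply: le_trans (xfar m k); rewrite ler_pM2r ?invr_gt0 ?N0 //.
  by rewrite ge_min CJ orbT.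
rewrite NegzE far_origins_negP -/x -/(D _).
move: m.+1 => j; have [Jj|jJ] := leqP J j.
  have [/andP[eD De] xj] := largeJ j Jj.
  apply: (@le_trans _ _ (e / 2 * n%:R ^+ j)).
    by rewrite ler_pM2r // ge_min lexx.
  have [->|k0] := eqVneq k 0.
    rewrite mul0r subr0.
    by have := lerB_normD (D j) x; rewrite [D j + x]addrC; lra.
  have kN : n%:R ^+ j <= `|k%:~R * n%:R ^+ j| :> R.
    rewrite normrM (gtr0_norm (N0 j)) ler_peMl ?(ltW (N0 j)) //.
    by rewrite -intr_norm ler1z; lia.
  have := ler_normD (k%:~R * n%:R ^+ j - (x + D j)) (x + D j).
  rewrite subrK distrC.
  have := ler_normD x (D j).
  lra.
(* For j < J, D j - k n^j is an integer, so x is at distance at least C of its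
   opposite, and C >= C / n^J * n^j. *)
have := xfar 0 (k * n%:Z ^+ j - (location a j 0 s - location a' j 0 s)).
rewrite expr0 !divr1 intrB intrM rmorphXn /= -/(D j) opprB addrA => xC.
apply: le_trans xC.
apply: (@le_trans _ _ (C / n%:R ^+ J * n%:R ^+ j)).
  by rewrite ler_pM2r // ge_min lexx orbT.
rewrite mulrAC ler_pdivrMr // ler_pM2l // ler_weXn2l ?ler1n // ltnW.
Unshelve. all: by end_near.
Qed.

(** * Boundary points inside a side of a cube *)

(** The left end is excluded because a left-closed grid cube may start there;
    the right end is included because a grid cube does not contain its own. *)
Definition crosses {R : realType} {d : nat} (Q : cube R d) (s : 'I_d)
    (p : R) : Prop := corner Q 0 s < p <= corner Q 0 s + side Q.

(** A boundary point of generation m is one of every finer generation too, and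
    no cube of such a generation contains it away from its left end. *)
Lemma crosses_coarser {R : realType} {d n : nat} {delta : 'rV[R]_d}
    {a : nat -> 'rV['I_n]_d} {Q Q' : cube R d} (s : 'I_d) {m m' : int}
    (k : int) :
  (1 < n)%N -> generation delta a m' Q' ->
  cube_faces (fun=> (true, false)) Q `<=` hopen Q' ->
  crosses Q s (origin delta a m 0 s + k%:~R / n%:R ^ m) -> m' < m.
Proof.
move=> n_gt1 [z [cz sz]] QQ' /andP[cp pc]; rewrite ltNge; apply/negP => mm'.
have [p ep] := origin_sub delta a n_gt1 s mm'.
have Q0 := side_gt0 Q.
have : hopen Q' (corner Q).
  by apply: QQ' => t; rewrite in_itv /= lexx lerDl ltW.
move=> /(_ s); rewrite in_itv /= cz sz => /andP[lo _].
have : hopen Q' (\row_t (corner Q 0 t + side Q)).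
  by apply: QQ' => t; rewrite mxE in_itv /= lexx lerDl ltW.
move=> /(_ s); rewrite mxE in_itv /= cz sz => /andP[_ hi].
have [j ej] : exists j : nat, m' = m + j%:Z.
  by exists `|m' - m|%N; rewrite gez0_abs ?subr_ge0// [RHS]addrC subrK.
have n0 : n%:R != 0 :> R by rewrite pnatr_eq0 -lt0n ltnW.
have eV : (n%:R ^ m)^-1 = (n%:Z ^+ j)%:~R / n%:R ^ m' :> R.
  rewrite rmorphXn /= ej expfzDr // -exprnP invfM mulrCA divff ?mulr1 //.
  by rewrite expf_neq0.
have u0 : 0 < (n%:R ^ m')^-1 :> R by rewrite invr_gt0 exprz_gt0 // ltr0n ltnW.
have := le_lt_trans lo cp; have := le_lt_trans pc hi.
rewrite eV ep mulrA -!addrA !ltrD2l -!mulrDl -intrM -intrD ltr_pM2r //.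
rewrite -[1]/(1%:~R) -intrD !ltr_pM2r // !ltr_int; lia.
Qed.

(** The candidate is the generation-m cube that contains the corner of Q; if it
    misses part of Q, then its right end in some coordinate is crossed by Q. *)
Lemma fits_or_crosses {R : realType} {d n : nat} (delta : 'rV[R]_d)
    (a : nat -> 'rV['I_n]_d) (b : 'I_d -> bool * bool) (Q : cube R d) (m : int) :
  (1 < n)%N ->
  (exists2 Q', generation delta a m Q' & cube_faces b Q `<=` hopen Q') \/
  (exists s k, crosses Q s (origin delta a m 0 s + k%:~R / n%:R ^ m)).
Proof.
move=> n_gt1; have h0 : 0 < 1 / n%:R ^ m :> R.
  by rewrite div1r invr_gt0 exprz_gt0 // ltr0n ltnW.
have [|/forallNP nocross] := pselect (exists s k,
  crosses Q s (origin delta a m 0 s + k%:~R / n%:R ^ m)); first by right.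
left; pose o := origin delta a m.
pose k s := Num.floor ((corner Q 0 s - o 0 s) * n%:R ^ m).
pose c : 'rV[R]_d := \row_s (o 0 s + (k s)%:~R / n%:R ^ m).
exists (Cube c h0).
  by exists (\row_s k s); split=> // s; rewrite !mxE.
move=> x Qx s; have := Qx s; rewrite !in_itv /= mxE => /andP[xlo xhi].
have /andP[klo khi] := floor_itv ((corner Q 0 s - o 0 s) * n%:R ^ m).
rewrite -/(k s) in klo khi.
have X0 : 0 < n%:R ^ m :> R by rewrite exprz_gt0 // ltr0n ltnW.
rewrite -ler_pdivrMr // lerBrDl in klo.
rewrite -ltr_pdivlMr // ltrBlDl in khi.
have := nocross s; move=> /forallNP/(_ (k s + 1)); rewrite /crosses khi /=.
move=> /negP; rewrite -ltNge => Qhi.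
apply/andP; split.
  by apply: le_trans klo _; move: xlo; case: (b s).1 => //= /ltW.
rewrite -addrA -mulrDl -[1]/(1%:~R) -intrD.
by apply: le_lt_trans Qhi; move: xhi; case: (b s).2 => //= /ltW.
Qed.

(** * Adjacency as pairwise separation *)

(** There is one grid more than there are sides of a cube, so when every grid
    crosses some side, two grids share one; and it suffices that two do. *)
Lemma adjacent_gridsP (R : realType) (d n : nat) (n_gt1 : (1 < n)%N)
    (delta : 'I_d.+1 -> 'rV[R]_d) (a : 'I_d.+1 -> nat -> 'rV['I_n]_d) :
  adjacent_grids (fun i => location_grid (delta i) (a i) n_gt1) <->
  forall (i j : 'I_d.+1) (s : 'I_d), i <> j ->
    exists2 c : R, 0 < c & far_origins (delta i) (delta j) (a i) (a j) s c.
Proof.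
have n0 : 0 < n%:R :> R by rewrite ltr0n ltnW.
have X0 (m : int) : 0 < n%:R ^ m :> R by rewrite exprz_gt0.
split=> [[C [C0 adj]] i j s ij | far].
  (* Any c with C c < 1 works: then C l < n^-m below. *)
  exists (C + 1)^-1; first by rewrite invr_gt0; lra.
  move=> m k; rewrite leNgt; apply/negP => close.
  set l := (C + 1)^-1 / n%:R ^ m in close.
  have l0 : 0 < l by rewrite divr_gt0 // invr_gt0; lra.
  have /eqP/unlift_some[u0 iE _] := nesym ij.
  (* e enumerates the grids other than j by coordinates, with grid i at s. *)
  pose e t := lift j (tperm u0 s t).
  pose q := origin (delta j) (a j) m 0 s + k%:~R / n%:R ^ m.
  pose p t := origin (delta (e t)) (a (e t)) m 0 t.
  (* Each side ends at a boundary point of its grid; side s is shared by i and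
     j, so it ends at the larger of their two close boundary points. *)
  pose corn : 'rV[R]_d :=
    \row_t ((if t == s then Num.max (p s) q else p t) - l).
  have es : e s = i by rewrite /e tpermR -iE.
  have [i' [Q' [[m' _ gQ'] QQ' sQ']]] :=
    adj (fun=> (true, false)) (Cube corn l0).
  have pq : `|p s - q| < l by rewrite /p es /q opprD addrA.
  have m'm : m' < m.
    have [ji'|] := eqVneq j i'.
      apply: (crosses_coarser s k n_gt1 gQ' QQ').
      rewrite -ji' /crosses /= mxE eqxx -/q subrK.
      by move: pq; case: (leP (p s) q); rewrite ltr_norml => ? /andP[? ?]; lra.
    move=> /unlift_some[u i'E _]; pose t := tperm u0 s u.
    have et : e t = i' by rewrite /e tpermK -i'E.
    apply: (crosses_coarser t 0 n_gt1 gQ' QQ').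
    rewrite mul0r addr0 -et -/(p t) /crosses /= mxE subrK.
    have [->|_] := eqVneq t s; last by lra.
    by move: pq; case: (leP (p s) q); rewrite ltr_norml => ? /andP[? ?]; lra.
  have [z [_ sideE]] := gQ'.
  have : (n%:R ^ m)^-1 <= side Q'.
    rewrite sideE div1r lef_pV2 ?posrE ?X0 //.
    by rewrite ler_weXz2l ?(ltW m'm) ?ler1n ?(ltnW n_gt1).
  move=> /le_trans/(_ sQ'); rewrite leNgt => /negP; apply.
  rewrite /= /l mulrA -[ltRHS]mul1r ltr_pM2r ?invr_gt0 //.
  by rewrite ltr_pdivrMr; lra.
have /choice[c cP] (p : 'I_d.+1 * 'I_d.+1 * 'I_d) : exists c : R, 0 < c /\
    (p.1.1 <> p.1.2 -> far_origins (delta p.1.1) (delta p.1.2)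
       (a p.1.1) (a p.1.2) p.2 c).
  (* On the diagonal the value 1 is a filler, harmless in the minimum below. *)
  have [->|/eqP ne] := eqVneq p.1.1 p.1.2; first by exists 1.
  by have [c c0 cfar] := far _ _ p.2 ne; exists c.
pose c0 := \big[Num.min/1]_p c p.
have c0_gt0 : 0 < c0.
  by apply: lt_bigmin => // p _; have [] := cP p.
exists (n%:R / c0); split; first exact: divr_gt0.
move=> b Q; have Q0 := side_gt0 Q.
have [m /andP[lm mu]] := expz_bracket n n_gt1 (divr_gt0 Q0 c0_gt0).
have [[i [Q' gQ' QQ']]|nofit] := pselect (exists i, exists2 Q',
    generation (delta i) (a i) m Q' & cube_faces b Q `<=` hopen Q').
  exists i, Q'; split=> //; first by exists m.
  have [z [_ ->]] := gQ'.
  by rewrite div1r mulrAC -mulrA.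
have /choice[f fP] (i : 'I_d.+1) : exists s, exists k,
    crosses Q s (origin (delta i) (a i) m 0 s + k%:~R / n%:R ^ m).
  have [fit|//] := fits_or_crosses (delta i) (a i) b Q m n_gt1.
  by case: nofit; exists i.
have /injectivePn[i [j /eqP ij fij]] : ~~ injectiveb f.
  apply/negP => /injectiveP/leq_card; rewrite !card_ord; lia.
have [ki /andP[ilo ihi]] := fP i.
have [kj] := fP j; rewrite -fij => /andP[jlo jhi].
have := (cP (i, j, f i)).2 ij m (kj - ki); rewrite /= leNgt => /negP[].
apply: (@lt_le_trans _ _ (c0 / n%:R ^ m)); last first.
  by rewrite ler_pM2r ?invr_gt0 //; apply: bigmin_le.
rewrite ltr_pdivrMr // mulrC in lm.
apply: le_lt_trans lm.
rewrite intrB mulrBl ler_norml; lra.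
Qed.

Theorem theorem1p5 (R : realType) (d n : nat) (d_gt0 : (0 < d)%N)
    (n_gt1 : (1 < n)%N) (delta : 'I_d.+1 -> 'rV[R]_d)
    (a : 'I_d.+1 -> nat -> 'rV['I_n]_d) :
  adjacent_grids (fun i => location_grid (delta i) (a i) n_gt1) <->
  (forall (l1 l2 : 'I_d.+1) (s : 'I_d), l1 <> l2 ->
     n_far n (delta l1 0 s - delta l2 0 s)) /\
  (forall (k1 k2 : 'I_d.+1) (s : 'I_d), k1 <> k2 ->
     let u := fun j : nat => (location_gap R (a k1) (a k2) s j)%:E in
     [/\ (0 < limn_einf u)%E, (limn_einf u <= limn_esup u)%E
       & (limn_esup u < 1)%E]).
Proof.
rewrite adjacent_gridsP; split=> [far | [delta_far gaps] i j s ij].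
  by split=> i j s ij; have /far_originsP-/(_ n_gt1)[? ?] := far i j s ij;
    last exact/gap_limitsP.
apply/far_originsP => //; split; first exact: delta_far.
by apply/gap_limitsP; apply: gaps.
Qed.
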